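(* Let $d$ subspaces $\mathcal{W}_j$, $j=1,\dots,d$, be given, where $\mathcal{W}_j$ is the span of the columns of a matrix $\Theta_j$, and let $P_j=\Theta_j\Theta_j^\dagger$ be the projection onto $\mathcal{W}_j$. Let $k\in\{1,\dots,d\}$ and $t>0$, and let $y_k$ be a noiseless measurement vector originating from regime $k$, decomposed as $$y_k=\widetilde{y}_k+\widetilde{y}_k^\perp,\qquad \widetilde{y}_k\in\mathcal{W}_k,\qquad \widetilde{y}_k^\perp\perp\mathcal{W}_k .$$ Assume that $\|\widetilde{y}_k^\perp\|_2\le\epsilon\,\|\widetilde{y}_k\|_2$, and let $$\eta_{jk}:=\|P_jP_k\|_2=\max_{y\neq 0}\frac{\|P_jP_ky\|_2}{\|y\|_2},\qquad j,k\in\{1,\dots,d\}.$$ If $$\eta=\max_{j\neq k}\eta_{jk}<1-\epsilon ,$$ then the classification $$k^\star=\arg\min_{i=1,\dots,d}\|y_k-P_iy_k\|_2=\arg\max_{i=1,\dots,d}\|P_iy_k\|_2$$ is successful, i.e. $k^\star=k$.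
   Context: There are $d$ regimes of a dynamical system with state $x(t)$. Regime $j$ is represented in measurement space by a matrix $\Theta_j$ (possibly complex), whose columns are the sensed basis functions of that regime and span the subspace $\mathcal{W}_j$. The system operates in regime $k$, and $y_k$ consists of noiseless linear measurements $Cx_k(t)$ of the state $x_k(t)$, where $C$ is the measurement matrix, taken either at a single time instant $t$ or stacked over several consecutive time instants (with the $\Theta_j$ and $P_j$ being the corresponding single-time or time-augmented matrices, so that they act on vectors of the same length as $y_k$). $\Theta^\dagger$ denotes the Moore-Penrose pseudoinverse, so $\Theta_j\Theta_j^\dagger$ is the orthogonal projection onto $\mathcal{W}_j$. $\|\cdot\|_2$ is the Euclidean norm for vectors and the induced spectral norm for matrices, and $\perp$ denotes orthogonality. The number $\epsilon$ is a (small) bound on the error of approximating data of regime $k$ in $\mathcal{W}_k$. The classification algorithm assigns to a measurement vector $y$ the regime index $k^\star$ whose projection is closest to $y$, equivalently the index $i$ maximizing $\|P_iy\|_2$. Classification of a measurement $y_k$ originating from regime $k$ is called successful if $k^\star=k$.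
   Formalization: The measurement vector y_k is assumed to be nonzero; for y_k = 0 all projections P_i y_k vanish, every index is a minimizer and a maximizer, and k* is not determined when d ≥ 2. *)

(* Defs.v *)
From HB Require Import structures.
From mathcomp Require Import all_boot all_order all_algebra.
From mathcomp Require Import complex.
From mathcomp Require Import boolp classical_sets reals.

Set Implicit Arguments.
Unset Strict Implicit.
Unset Printing Implicit Defensive.

Import Order.TTheory GRing.Theory Num.Theory.
Local Open Scope ring_scope.
Local Open Scope complex_scope.
Local Open Scope sesquilinear_scope.

Section Euclidean.
Variable R : realType.

Definition l2norm n (v : 'cV[R[i]]_n) : R :=
  Num.sqrt (\sum_i ComplexField.Normc.normc (v i 0) ^+ 2).

(* The quotients have a maximum as soon as the matrix has a column, see
   [spectral_norm_attained]; for an empty matrix the value is [sup set0 = 0]. *)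
Definition spectral_norm m n (A : 'M[R[i]]_(m, n)) : R :=
  sup [set l2norm (A *m v) / l2norm v | v in [set v : 'cV_n | v != 0]]%classic.

Definition colspan m n (A : 'M[R[i]]_(m, n)) : set 'cV[R[i]]_m :=
  range (fun c : 'cV_n => A *m c).

Definition orthogonal_to n (W : set 'cV[R[i]]_n) (v : 'cV[R[i]]_n) : Prop :=
  forall w, W w -> w ^t* *m v = 0.

Definition moore_penrose m n (A : 'M[R[i]]_(m, n)) (X : 'M[R[i]]_(n, m)) :=
  [/\ A *m X *m A = A, X *m A *m X = X,
      (A *m X) ^t* = A *m X & (X *m A) ^t* = X *m A].

Definition pinv m n (A : 'M[R[i]]_(m, n)) : 'M[R[i]]_(n, m) :=
  xget 0 [set X | moore_penrose A X]%classic.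

Lemma trmxC_mul m n p (A : 'M[R[i]]_(m, n)) (B : 'M[R[i]]_(n, p)) :
  (A *m B) ^t* = B ^t* *m A ^t*.
Proof. by rewrite trmx_mul map_mxM. Qed.

Lemma mulmx_trmxC_eq0 m n (A : 'M[R[i]]_(m, n)) : A *m A ^t* = 0 -> A = 0.
Proof.
move=> A0; apply/matrixP => i j; rewrite mxE.
have /eqP := congr1 (fun M : 'M_m => M i i) A0; rewrite !mxE.
under eq_bigr => k _ do rewrite !mxE -normCK.
rewrite psumr_eq0 => [/allP/(_ j (mem_index_enum _))|k _]; last exact: exprn_ge0.
by rewrite /= sqrf_eq0 normr_eq0 => /eqP.
Qed.

Lemma gram_unit m n (A : 'M[R[i]]_(m, n)) :
  row_free A -> A *m A ^t* \in unitmx.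
Proof.
move=> fA; rewrite -row_free_unit -kermx_eq0; apply/eqP.
set K := kermx _; have KA : K *m (A *m A ^t*) = 0 by exact: mulmx_ker.
have : K *m A = 0.
  by apply: mulmx_trmxC_eq0; rewrite trmxC_mul mulmxA -(mulmxA K) KA mul0mx.
by move/eqP; rewrite mulmx_free_eq0 // => /eqP.
Qed.

Lemma invmx_trmxC n (A : 'M[R[i]]_n) : A ^t* = A -> (invmx A) ^t* = invmx A.
Proof. by move=> hA; rewrite trmx_inv map_invmx hA. Qed.

Lemma moore_penrose_factor m n r (B : 'M[R[i]]_(m, r)) (C : 'M[R[i]]_(r, n)) U V :
    U ^t* = U -> V ^t* = V ->
    U *m (B ^t* *m B) = 1%:M -> C *m C ^t* *m V = 1%:M ->
  moore_penrose (B *m C) (C ^t* *m V *m (U *m B ^t*)).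
Proof.
move=> hU hV UB CV; set X := C ^t* *m V *m (U *m B ^t*).
have AX : B *m C *m X = B *m (U *m B ^t*).
  by rewrite /X -mulmxA; congr (B *m _); rewrite !mulmxA CV mul1mx.
have XA : X *m (B *m C) = C ^t* *m V *m C.
  by rewrite /X -mulmxA; congr (_ *m _); rewrite mulmxA -(mulmxA U) UB mul1mx.
split.
- rewrite AX -!mulmxA; congr (B *m _).
  by rewrite (mulmxA (B ^t*)) mulmxA UB mul1mx.
- rewrite XA /X [LHS]mulmxA; congr (_ *m (U *m _)).
  by rewrite -!mulmxA (mulmxA C) CV mulmx1.
- by rewrite AX !trmxC_mul trmxCK hU mulmxA.
- by rewrite XA !trmxC_mul trmxCK hV mulmxA.
Qed.

Lemma moore_penrose_exists m n (A : 'M[R[i]]_(m, n)) :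
  exists X, moore_penrose A X.
Proof.
have uC : row_base A *m (row_base A) ^t* \in unitmx.
  exact/gram_unit/row_base_free.
have uB : (col_base A) ^t* *m col_base A \in unitmx.
  rewrite -{2}(trmxCK (col_base A)); apply: gram_unit.
  by rewrite row_free_map -row_leq_rank mxrank_tr col_leq_rank col_base_full.
rewrite -[A in moore_penrose A](mulmx_base A); eexists.
apply: (moore_penrose_factor _ _ (mulVmx uB) (mulmxV uC)).
- by apply: invmx_trmxC; rewrite trmxC_mul trmxCK.
- by apply: invmx_trmxC; rewrite trmxC_mul trmxCK.
Qed.

Lemma moore_penrose_unique m n (A : 'M[R[i]]_(m, n)) X Y :
  moore_penrose A X -> moore_penrose A Y -> X = Y.
Proof.
move=> [X1 X2 X3 X4] [Y1 Y2 Y3 Y4].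
have AXY : A *m X = A *m Y.
  rewrite -X3 -{1}Y1 -(mulmxA (A *m Y)) trmxC_mul X3 Y3.
  by rewrite mulmxA X1.
have XAY : X *m A = Y *m A.
  rewrite -X4 -{1}Y1 -(mulmxA A) mulmxA trmxC_mul X4 Y4.
  by rewrite -mulmxA (mulmxA A) X1.
by rewrite -X2 XAY -mulmxA AXY mulmxA Y2.
Qed.

Lemma pinvP m n (A : 'M[R[i]]_(m, n)) : moore_penrose A (pinv A).
Proof.
rewrite /pinv; case: xgetP => [X _ //|h].
by have [X /h] := moore_penrose_exists A.
Qed.

Lemma l2normCK n (v : 'cV[R[i]]_n) :
  ((l2norm v ^+ 2)%:C) = (v ^t* *m v) 0 0.
Proof.
rewrite sqr_sqrtr ?sumr_ge0 // => [|i _]; last exact: sqr_ge0.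
rewrite mxE rmorph_sum; apply: eq_bigr => i _.
by rewrite !mxE mulrC -normCK rmorphXn.
Qed.

Lemma l2norm_ge0 n (v : 'cV[R[i]]_n) : 0 <= l2norm v.
Proof. exact: sqrtr_ge0. Qed.

Lemma l2norm_eq0 n (v : 'cV[R[i]]_n) : (l2norm v == 0) = (v == 0).
Proof.
apply/eqP/eqP => [v0|->]; last first.
  apply/eqP; rewrite -sqrf_eq0; apply/eqP/(@complexI R).
  by rewrite l2normCK mulmx0 mxE.
have /(congr1 (fun M => M ^t*)) : v ^t* = 0; last first.
  by rewrite trmxCK trmx0 map_mx0.
apply: mulmx_trmxC_eq0; rewrite trmxCK; apply/matrixP => i j.
by rewrite !ord1 -l2normCK v0 expr0n mxE.
Qed.

Lemma spectral_norm_attained m n (A : 'M[R[i]]_(m, n.+1)) :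
  exists2 v : 'cV_n.+1, v != 0 & spectral_norm A = l2norm (A *m v) / l2norm v.
Proof.
pose H := A ^t* *m A; pose P := spectralmx H; pose D := spectral_diag H.
have uP : P \is unitarymx by exact: spectral_unitarymx.
have PK : P *m P ^t* = 1%:M by exact/unitarymxP.
have KP : P ^t* *m P = 1%:M by exact: mulmx1C.
have defH : H = P ^t* *m diag_mx D *m P.
  rewrite -(invmx_unitary uP); apply/orthomx_spectralP/normalmxP.
  by rewrite !trmxC_mul trmxCK.
have nP v : l2norm (P *m v) = l2norm v.
  apply/eqP; rewrite -(@eqrXn2 _ 2) ?l2norm_ge0 //; apply/eqP/(@complexI R).
  by rewrite !l2normCK trmxC_mul !mulmxA -(mulmxA _ _ P) KP mulmx1.
have nA v : (l2norm (A *m v) ^+ 2)%:C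
    = \sum_i D 0 i * (ComplexField.Normc.normc ((P *m v) i 0) ^+ 2)%:C.
  rewrite l2normCK trmxC_mul mulmxA -(mulmxA _ _ A) -/H defH.
  rewrite !mulmxA -trmxC_mul -(mulmxA _ P) mxE; apply: eq_bigr => i _.
  set w := P *m v; rewrite mul_mx_diag !mxE [_ * D 0 i]mulrC -mulrA; congr (_ * _).
  by rewrite [LHS]mulrC -normCK rmorphXn.
pose u i := P ^t* *m delta_mx i 0 : 'cV[R[i]]_n.+1.
pose s i := l2norm (A *m u i) ^+ 2.
have Pu i : P *m u i = delta_mx i 0 by rewrite mulmxA PK mul1mx.
have sE i : D 0 i = (s i)%:C.
  rewrite /s nA (bigD1 i) //= Pu big1 => [|j ji]; rewrite !mxE.
    by rewrite !eqxx ComplexField.Normc.normc1 expr1n mulr1 addr0.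
  by rewrite (negPf ji) ComplexField.Normc.normc0 expr0n mulr0.
have [k _ kP] := arg_maxP s (erefl : xpredT (ord0 : 'I_n.+1)).
have u1 : l2norm (u k) = 1.
  apply/eqP; rewrite -(@eqrXn2 _ 2) ?l2norm_ge0 // -nP Pu; apply/eqP/(@complexI R).
  rewrite l2normCK trmx_delta map_delta_mx mul_delta_mx expr1n.
  by rewrite mxE !eqxx.
have uN0 : u k != 0 by rewrite -l2norm_eq0 u1 oner_eq0.
have le_k v : l2norm (A *m v) <= l2norm (A *m u k) * l2norm v.
  rewrite -(@ler_pXn2r _ 2) ?nnegrE ?mulr_ge0 ?l2norm_ge0 //.
  rewrite exprMn -(nP v) -/(s k); clearbody s.
  have -> : l2norm (A *m v) ^+ 2
      = \sum_i s i * ComplexField.Normc.normc ((P *m v) i 0) ^+ 2.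
    apply/(@complexI R); rewrite nA rmorph_sum.
    by apply: eq_bigr => i _; rewrite sE; exact/esym/(rmorphM (real_complex R)).
  rewrite [l2norm (P *m v)]/l2norm.
  rewrite sqr_sqrtr ?sumr_ge0 // => [|i _]; last exact: sqr_ge0.
  rewrite [leRHS]mulr_sumr; apply: ler_sum => i _.
  by apply: ler_wpM2r; [exact: sqr_ge0 | exact: kP].
exists (u k) => //; rewrite u1 divr1.
apply/le_anti/andP; split.
  apply: ge_sup; first by exists (l2norm (A *m u k) / l2norm (u k)); exists (u k).
  move=> _ [v /= vN0 <-]; rewrite ler_pdivrMr ?le_k //.
  by rewrite lt_def l2norm_eq0 vN0 l2norm_ge0.
apply: ub_le_sup; last by exists (u k) => //; rewrite u1 divr1.
exists (l2norm (A *m u k)) => _ [v /= vN0 <-]; rewrite ler_pdivrMr ?le_k //.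
by rewrite lt_def l2norm_eq0 vN0 l2norm_ge0.
Qed.

(* Orthogonal projection onto [colspan A]. *)
Definition proj m n (A : 'M[R[i]]_(m, n)) : 'M[R[i]]_m := A *m pinv A.

Definition eta d m (n : 'I_d -> nat) (Theta : forall j, 'M[R[i]]_(m, n j))
    (j k : 'I_d) : R :=
  spectral_norm (proj (Theta j) *m proj (Theta k)).

(* Snapshots [C x(tau_0), ..., C x(tau_s)] stacked on top of each other; [s = 0]
   is the measurement at a single instant. *)
Definition measurement p N (C : 'M[R[i]]_(p, N)) (x : R -> 'cV[R[i]]_N)
    s (tau : 'I_s.+1 -> R) : 'cV[R[i]]_(\sum_(i < s.+1) p) :=
  \mxcol_(i < s.+1) (C *m x (tau i)).

(* All minimizers (resp. maximizers), so that [argmin f = [set k]] means that [k]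
   is selected whatever the tie-breaking rule. *)
Definition argmin (T : finType) (f : T -> R) : {set T} :=
  [set i | [forall j, f i <= f j]]%SET.

Definition argmax (T : finType) (f : T -> R) : {set T} :=
  [set i | [forall j, f j <= f i]]%SET.

End Euclidean.

(* Main.v *)
Require Import Defs.
From mathcomp Require Import all_boot all_order all_algebra.
From mathcomp Require Import complex.
From mathcomp Require Import boolp classical_sets reals.

Set Implicit Arguments.
Unset Strict Implicit.
Unset Printing Implicit Defensive.

Import Order.TTheory GRing.Theory Num.Theory.
Local Open Scope ring_scope.
Local Open Scope complex_scope.

(* Write [y~] for the component of [y_k] in [W_k], so that [P_k y_k = y~]. For
   [j <> k],
     [|P_j y_k| <= |P_j P_k y~| + |P_j y_perp|
                <= (eta + eps) |y~| < |y~| = |P_k y_k|],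
   where [y~ <> 0] because [y_k <> 0]. The residuals are ordered oppositely to
   the projections since [|y - P_i y|^2 = |y|^2 - |P_i y|^2]. *)

Section Projections.
Variable R : realType.
Local Open Scope sesquilinear_scope.

(** [dotmx] is a form on row vectors, hence the transposes; this identification carries its triangle
    inequality over to [l2norm]. *)
Lemma sqrtC_dotmx_tr n (v : 'cV[R[i]]_n) :
  sqrtC (dotmx v^T v^T) = (l2norm v)%:C.
Proof.
have -> : dotmx v^T v^T = (l2norm v)%:C ^+ 2.
  rewrite dotmxE -rmorphXn /= l2normCK !mxE.
  by apply: eq_bigr => i _; rewrite !mxE mulrC.
by rewrite sqrCK // lecR l2norm_ge0.
Qed.

Lemma l2normD n (u v : 'cV[R[i]]_n) : l2norm (u + v) <= l2norm u + l2norm v.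
Proof.
have [+ _] := triangle_lerif (@dotmx R[i] n) u^T v^T.
by rewrite -linearD /= !sqrtC_dotmx_tr -rmorphD lecR.
Qed.

(** The a priori bound [M] makes the set of quotients bounded above, so that its [sup] is a true
    upper bound. The zero vector has no quotient in that set and is treated apart. *)
Lemma spectral_norm_ub m n (A : 'M[R[i]]_(m, n)) M (v : 'cV_n) :
  (forall w : 'cV_n, l2norm (A *m w) <= M * l2norm w) ->
  l2norm (A *m v) <= spectral_norm A * l2norm v.
Proof.
move=> ubA; have norm_gt0 (w : 'cV[R[i]]_n) : w != 0 -> 0 < l2norm w.
  by move=> w0; rewrite lt_def l2norm_eq0 w0 l2norm_ge0.
have [->|v0] := eqVneq v 0.
  have norm0 p : l2norm (0 : 'cV[R[i]]_p) = 0 by apply/eqP; rewrite l2norm_eq0.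
  by rewrite mulmx0 !norm0 mulr0.
rewrite -ler_pdivrMr ?norm_gt0 //; apply: ub_le_sup; last by exists v.
by exists M => _ [w /= w0 <-]; rewrite ler_pdivrMr ?norm_gt0.
Qed.

Section OneProjection.
Variables (m n : nat) (A : 'M[R[i]]_(m, n)).
Implicit Type v : 'cV[R[i]]_m.

Lemma proj_trmxC : (proj A)^t* = proj A.
Proof. by have [] := pinvP A. Qed.

Lemma proj_id v : colspan A v -> proj A *m v = v.
Proof. by have [AXA _ _ _] := pinvP A; move=> [c _ <-]; rewrite mulmxA AXA. Qed.

Lemma colspan_proj v : colspan A (proj A *m v).
Proof. by exists (pinv A *m v); last exact: mulmxA. Qed.

Lemma proj_adjoint v (w : 'cV_m) : (proj A *m v)^t* *m w = v^t* *m (proj A *m w).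
Proof. by rewrite trmxC_mul proj_trmxC -mulmxA. Qed.

(** With [P := proj A] self-adjoint and fixing [P v], [|P v|^2 = <P (P v), v> = <P v, v>], which
    vanishes because [P v] lies in [colspan A]. *)
Lemma proj_orthogonal v : orthogonal_to (colspan A) v -> proj A *m v = 0.
Proof.
move=> Av; apply/eqP; rewrite -l2norm_eq0 -sqrf_eq0.
apply/eqP/(@complexI R); rewrite l2normCK -proj_adjoint.
by rewrite (proj_id (colspan_proj v)) (Av _ (colspan_proj v)) mxE.
Qed.

(** Pythagoras: the cross terms cancel because the projection is self-adjoint and idempotent. *)
Lemma l2norm_proj v :
  l2norm v ^+ 2 = l2norm (proj A *m v) ^+ 2 + l2norm (v - proj A *m v) ^+ 2.
Proof.
set P := proj A; have PP : P *m (P *m v) = P *m v.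
  exact/proj_id/colspan_proj.
have hP := proj_adjoint v; rewrite -/P in hP.
apply/(@complexI R); rewrite rmorphD /= !l2normCK [(_ - _)^T]linearB map_mxB.
rewrite mulmxBl !mulmxBr !hP PP subrr subr0 !mxE.
by rewrite addrCA subrr addr0.
Qed.

Lemma l2norm_proj_le v : l2norm (proj A *m v) <= l2norm v.
Proof.
rewrite -(@ler_pXn2r _ 2) ?nnegrE ?l2norm_ge0 //.
by rewrite [leRHS]l2norm_proj lerDl sqr_ge0.
Qed.

End OneProjection.

Lemma ler_residual_proj m n1 n2 (A : 'M[R[i]]_(m, n1)) (B : 'M[R[i]]_(m, n2))
    (v : 'cV[R[i]]_m) :
  (l2norm (v - proj A *m v) <= l2norm (v - proj B *m v)) =
  (l2norm (proj B *m v) <= l2norm (proj A *m v)).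
Proof.
rewrite -[LHS](@ler_pXn2r _ 2) ?nnegrE ?l2norm_ge0 //.
rewrite -[RHS](@ler_pXn2r _ 2) ?nnegrE ?l2norm_ge0 //.
have := l2norm_proj A v; rewrite (l2norm_proj B v) => e.
(* Adding [|P_A v|^2] to both squared residuals turns the left side into [|v|^2], which [e] splits
   along [B]; the residual of [B] then cancels. *)
by rewrite -(lerD2l (l2norm (proj A *m v) ^+ 2)) -e lerD2r.
Qed.

End Projections.

Theorem proposition4p4 (R : realType) (d N p s : nat)
    (C : 'M[R[i]]_(p, N)) (x : 'I_d -> R -> 'cV[R[i]]_N)
    (n : 'I_d -> nat)
    (Theta : forall j : 'I_d, 'M[R[i]]_(\sum_(i < s.+1) p, n j))
    (k : 'I_d) (tau : 'I_s.+1 -> R)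
    (y ytilde yperp : 'cV[R[i]]_(\sum_(i < s.+1) p)) (eps : R)
    (tau_gt0 : forall i : 'I_s.+1, 0 < tau i)
    (y_measured : y = measurement C (x k) tau)
    (y_neq0 : y != 0)
    (y_decomposition : y = ytilde + yperp)
    (ytilde_in : colspan (Theta k) ytilde)
    (yperp_orthogonal : orthogonal_to (colspan (Theta k)) yperp)
    (yperp_small : l2norm yperp <= eps * l2norm ytilde)
    (eta_lt : \big[Num.max/0]_(j < d | j != k) eta Theta j k < 1 - eps) :
  argmin (fun i : 'I_d => l2norm (y - proj (Theta i) *m y)) = [set k]%SET /\
  argmax (fun i : 'I_d => l2norm (proj (Theta i) *m y)) = [set k]%SET.
Proof.
set P := fun j => proj (Theta j).
have PkE : P k *m y = ytilde.
  by rewrite y_decomposition mulmxDr proj_id // proj_orthogonal // addr0.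
have ytilde_gt0 : 0 < l2norm ytilde.
  rewrite lt_def l2norm_ge0 andbT l2norm_eq0.
  (* If [ytilde] vanished, [yperp_small] would force [yperp = 0], hence [y = 0]. *)
  apply: contraNneq y_neq0 => yt0; rewrite y_decomposition yt0 add0r.
  rewrite -l2norm_eq0 eq_le l2norm_ge0 andbT (le_trans yperp_small) //.
  have /eqP -> : l2norm ytilde == 0 by rewrite l2norm_eq0 yt0.
  by rewrite mulr0.
have lt_k j : j != k -> l2norm (P j *m y) < l2norm (P k *m y).
  move=> jk; have etajk : eta Theta j k < 1 - eps.
    exact: le_lt_trans (le_bigmax_cond 0 (fun j => eta Theta j k) jk) eta_lt.
  have le_eta : l2norm (P j *m ytilde) <= eta Theta j k * l2norm ytilde.
    (* Writing [ytilde] as [P k *m ytilde] makes the product defining [eta] appear; the a priori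
       bound is 1, since both projections are contractions. *)
    rewrite -[ytilde in leLHS](proj_id ytilde_in) mulmxA.
    apply: (@spectral_norm_ub _ _ _ _ 1) => w.
    by rewrite mul1r -mulmxA !(le_trans (l2norm_proj_le _ _)).
  rewrite PkE y_decomposition mulmxDr; apply: le_lt_trans (l2normD _ _) _.
  have le_eps := le_trans (l2norm_proj_le (Theta j) yperp) yperp_small.
  apply: le_lt_trans (lerD le_eta le_eps) _.
  by rewrite -mulrDl gtr_pMl // -ltrBrDr.
have max_k : argmax (fun i => l2norm (P i *m y)) = [set k]%SET.
  apply/setP => i; rewrite !inE; apply/forallP/eqP => [/(_ k)|-> j].
    (* Strictness excludes ties: any other index loses to [k]. *)
    by apply: contraTeq => /lt_k; rewrite ltNge.
  by have [->//|/lt_k/ltW] := eqVneq j k.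
(* Each pairwise comparison of residuals is equivalent to the reversed comparison of projections, so
   minimizers and maximizers coincide. *)
split=> //; rewrite -max_k; apply/setP => i; rewrite !inE.
by apply: eq_forallb => j; rewrite ler_residual_proj.
Qed.
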